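(* Suppose $B\in\mathbb{C}^{m\times n}$, $\tilde W\in\mathbb{C}^{n\times m}$ and $\tilde k=\mathrm{ind}(B\tilde W)$. Assume that $X\in\mathbb{C}^{m\times n}$ is a minimal rank $W$-weighted weak Drazin inverse of $B$, $Y=B^{\dagger}B\tilde W X\tilde W$ and $\mathfrak{D}=B+E\in\mathbb{C}^{m\times n}$. If $\mathcal R(E)\subseteq\mathcal R(E\tilde W)\subseteq\mathcal R((B\tilde W)^{\tilde k})$, $\mathcal R(E^* )\subseteq\mathcal R((E\tilde W)^* )\subseteq\mathcal R((X\tilde W B\tilde W)^* )\subseteq\mathcal R(B^* )$ and $\max\{\|\tilde W E\tilde W X\|,\|B^{\dagger}E\|\}<1$, then $$\mathfrak{D}^{\dagger}X(I+\tilde W E\tilde W X)^{-1}\tilde W\mathfrak{D}\tilde W X=\mathfrak{D}^{\dagger}X\tilde W\mathfrak{D}\tilde W(I+X\tilde W E\tilde W)^{-1}X=(I+YE)^{-1}YX,$$ where $X(I+\tilde W E\tilde W X)^{-1}$ is the minimal rank $W$-weighted weak Drazin inverse of $\mathfrak{D}$. Furthermore, $$\mathfrak{D}\mathfrak{D}^{\dagger}X(I+\tilde W E\tilde W X)^{-1}\tilde W\mathfrak{D}\tilde W X=BYX$$ and $$\frac{\|YX\|}{1+\|YE\|}\le\bigl\|\mathfrak{D}^{\dagger}X(I+\tilde W E\tilde W X)^{-1}\tilde W\mathfrak{D}\tilde W X\bigr\|\le\frac{\|YX\|}{1-\|YE\|}.$$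
   Context: $\mathcal R(\cdot)$ denotes the range, $^*$ the conjugate transpose, $^{\dagger}$ the Moore-Penrose inverse, $I$ an identity matrix of the appropriate size, and $\|\cdot\|$ a matrix norm. For a square complex matrix $T$, $\mathrm{ind}(T)$ is the smallest nonnegative integer $k$ with $\mathrm{rank}(T^k)=\mathrm{rank}(T^{k+1})$ (with $T^0=I$). For $A\in\mathbb{C}^{m\times n}$ and $k=\mathrm{ind}(A\tilde W)$, a matrix $X\in\mathbb{C}^{m\times n}$ is a minimal rank $W$-weighted weak Drazin inverse of $A$ (with respect to the weight $\tilde W$) if $X\tilde W(A\tilde W)^{k+1}=(A\tilde W)^{k}$ and $\mathrm{rank}(X)=\mathrm{rank}((A\tilde W)^{k})$.
   Formalization: For m ≠ n the inclusions R(E* ) ⊆ R((EW̃)* ) and R((XW̃BW̃)* ) ⊆ R(B* ) compare subspaces of ℂⁿ and ℂᵐ and are undefined; they are required only when m = n, and the consequence R(E* ) ⊆ R(B* ) is assumed explicitly for all m, n. *)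

(* Defs.v *)
From mathcomp Require Import all_boot all_order all_algebra.
From mathcomp Require Import boolp classical_sets reals.
From mathcomp Require Import complex.

Set Implicit Arguments.
Unset Strict Implicit.
Unset Printing Implicit Defensive.

Import Order.TTheory GRing.Theory Num.Theory.

Local Open Scope ring_scope.
Local Open Scope sesquilinear_scope.
Local Open Scope complex_scope.
Local Open Scope classical_set_scope.

Section MoorePenrose.
Variable C : numClosedFieldType.

Definition penrose m n (A : 'M[C]_(m, n)) (X : 'M[C]_(n, m)) : bool :=
  [&& A *m X *m A == A, X *m A *m X == X,
      (A *m X)^t* == A *m X & (X *m A)^t* == X *m A].

Lemma trmxC_mul m n p (A : 'M[C]_(m, n)) (B : 'M[C]_(n, p)) :
  (A *m B)^t* = B^t* *m A^t*.
Proof. by rewrite trmx_mul map_mxM. Qed.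

Lemma row_free_gram_unit m n (G : 'M[C]_(m, n)) :
  row_free G -> G *m G^t* \in unitmx.
Proof.
move=> freeG; rewrite -row_free_unit -kermx_eq0; apply/rowV0P => u /sub_kermxP uG0.
have : (u *m G) *m (u *m G)^t* = 0 by rewrite trmxC_mul -!mulmxA [G *m _]mulmxA mulmxA uG0 mul0mx.
move=> /matrixP /(_ 0 0); rewrite !mxE => /eqP; rewrite psumr_eq0; last first.
  by move=> i _; rewrite !mxE -normCK exprn_ge0.
move=> /allP w0; have : u *m G = 0.
  apply/rowP => i; have := w0 i (mem_index_enum i).
  by rewrite !mxE -normCK expf_eq0 normr_eq0 /= => /eqP.
by move/eqP; rewrite mulmx_free_eq0 // => /eqP.
Qed.

Lemma penrose_exists m n (A : 'M[C]_(m, n)) : exists X, penrose A X.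
Proof.
have [r [F [G [fF fG AE]]]] : exists r (F : 'M[C]_(m, r)) (G : 'M[C]_(r, n)),
    [/\ row_free F^T, row_free G & A = F *m G].
  exists (\rank A), (col_base A), (row_base A); split; last by rewrite mulmx_base.
  - by rewrite /row_free mxrank_tr; have := col_base_full A.
  - exact: row_base_free.
have uG : G *m G^t* \in unitmx by exact: row_free_gram_unit.
have uF : F^t* *m F \in unitmx.
  rewrite -{2}[F]trmxCK; apply: row_free_gram_unit.
  by rewrite /row_free mxrank_map.
pose P := invmx (G *m G^t*); pose Q := invmx (F^t* *m F).
have hermV p (M : 'M[C]_p) : M^t* = M -> (invmx M)^t* = invmx M.
  by move=> hM; rewrite trmx_inv map_invmx hM.
have hP : P^t* = P by apply: hermV; rewrite trmxC_mul trmxCK.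
have hQ : Q^t* = Q by apply: hermV; rewrite trmxC_mul trmxCK.
exists (G^t* *m P *m Q *m F^t*).
have E1 : A *m (G^t* *m P *m Q *m F^t*) = F *m Q *m F^t*.
  by rewrite AE -!mulmxA [G *m _]mulmxA [G *m G^t* *m _]mulmxA mulmxV // mul1mx.
have E2 : (G^t* *m P *m Q *m F^t*) *m A = G^t* *m P *m G.
  rewrite [in LHS]AE -!mulmxA; congr (_ *m (_ *m _)).
  by rewrite [F^t* *m _]mulmxA mulmxA mulVmx // mul1mx.
apply/and4P; split; apply/eqP.
- rewrite E1 [X in _ *m X]AE [RHS]AE -!mulmxA; congr (_ *m _).
  by rewrite [F^t* *m _]mulmxA mulmxA mulVmx // mul1mx.
- rewrite E2 -!mulmxA; congr (_ *m (_ *m _)).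
  by rewrite [G *m _]mulmxA mulmxA mulmxV // mul1mx.
- by rewrite E1 !trmxC_mul trmxCK hQ mulmxA.
- by rewrite E2 !trmxC_mul trmxCK hP mulmxA.
Qed.

Definition mpinv m n (A : 'M[C]_(m, n)) : 'M[C]_(n, m) :=
  xchoose (penrose_exists A).

Lemma mpinvP m n (A : 'M[C]_(m, n)) : penrose A (mpinv A).
Proof. exact: xchooseP. Qed.

Lemma penrose_uniq m n (A : 'M[C]_(m, n)) X :
  penrose A X -> X = mpinv A.
Proof.
move: (mpinv A) (mpinvP A) => Y.
case/and4P => /eqP b1 /eqP b2 /eqP b3 /eqP b4 /and4P[/eqP a1 /eqP a2 /eqP a3 /eqP a4].
have AXY : A *m X = A *m Y.
  have : (A *m Y *m (A *m X))^t* = A *m X *m (A *m Y) by rewrite trmxC_mul a3 b3.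
  by rewrite !mulmxA b1 a1 a3.
have XAY : X *m A = Y *m A.
  have : (X *m A *m (Y *m A))^t* = Y *m A *m (X *m A) by rewrite trmxC_mul a4 b4.
  by rewrite -!mulmxA [A *m (Y *m A)]mulmxA b1 [A *m (X *m A)]mulmxA a1 a4.
by rewrite -a2 XAY -mulmxA AXY mulmxA b2.
Qed.

End MoorePenrose.

Section Index.
Variable F : fieldType.

Lemma mxind_exists m (T : 'M[F]_m) :
  exists k, \rank (T ^+ k) == \rank (T ^+ k.+1).
Proof.
have [//|noeq] := pselect (exists k, \rank (T ^+ k) == \rank (T ^+ k.+1)).
have dec k : (\rank (T ^+ k) + k <= m)%N.
  elim: k => [|k IH]; first by rewrite addn0 rank_leq_row.
  have le : (\rank (T ^+ k.+1) <= \rank (T ^+ k))%N.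
    by rewrite exprS; exact: mxrankM_maxr.
  have ne : \rank (T ^+ k) != \rank (T ^+ k.+1).
    by apply/negP => e; apply: noeq; exists k.
  rewrite addnS -addSn; apply: leq_trans IH; rewrite leq_add2r.
  by rewrite ltn_neqAle eq_sym ne.
by have := dec m.+1; rewrite addnS ltnNge leq_addl.
Qed.

Definition mxind m (T : 'M[F]_m) : nat := ex_minn (mxind_exists T).

Definition mxrange p q (A : 'M[F]_(p, q)) : set 'cV[F]_p :=
  range (fun v : 'cV[F]_q => A *m v).

(* Inclusion of two ranges whose ambient spaces F^p and F^p' are not known to
   coincide: it is the usual inclusion if p = p', and imposes nothing
   otherwise. *)
Definition mxrange_le p q p' q' (A : 'M[F]_(p, q)) (B : 'M[F]_(p', q')) : Prop :=
  forall e : p = p', mxrange (castmx (e, erefl q) A) `<=` mxrange B.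

Definition min_rank_weak_drazin m n (A : 'M[F]_(m, n)) (W : 'M[F]_(n, m))
    (X : 'M[F]_(m, n)) : Prop :=
  let k := mxind (A *m W) in
  X *m W *m (A *m W) ^+ k.+1 = (A *m W) ^+ k /\
  \rank X = \rank ((A *m W) ^+ k).

End Index.

(* Homogeneity is stated in R[i], where the modulus of a lives. *)
Record matrix_norm (R : realType) (n : nat) (N : 'M[R[i]]_n -> R) : Prop := {
  matrix_norm_ge0 : forall A, 0 <= N A;
  matrix_norm_eq0 : forall A, N A = 0 -> A = 0;
  matrix_normZ : forall (a : R[i]) A, (N (a *: A))%:C = `|a| * (N A)%:C;
  matrix_normD : forall A B, N (A + B) <= N A + N B;
  matrix_normM : forall A B, N (A *m B) <= N A * N B
}.

(* Main.v *)
(** Put [T = B W], [k = ind T] and [M = X W]. The range of [X] is that of [T ^+ k],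
    which is invariant under [T] and on which [T] and [M] are mutually inverse.
    As [E] has its range there, [B Y E = E], so that [D = B (1 + Y E)] and
    [Y E = B^+ E], and [D W = T (1 + M E W)]. The first factorization yields
    [D^+ = (1 + Y E)^-1 B^+]; by the second one, [X (1 + W E W X)^-1] inverts
    [D W] on the range of [X]. Hence all the products in the statement collapse
    to [D^+ X = (1 + Y E)^-1 Y X], whose norm is estimated from the identity
    [Q + (Y E) Q = Y X] with [Q = D^+ X]. *)

Require Import Defs.
From mathcomp Require Import all_boot all_order all_algebra.
From mathcomp Require Import boolp classical_sets reals.
From mathcomp Require Import complex.

Set Implicit Arguments.
Unset Strict Implicit.
Unset Printing Implicit Defensive.

Import Order.TTheory GRing.Theory Num.Theory.

Local Open Scope ring_scope.
Local Open Scope sesquilinear_scope.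
Local Open Scope classical_set_scope.

(** * Range inclusions as matrix factorizations, and push-through identities *)

Section Factorization.
Variable F : fieldType.

Lemma mxrange_subP m p q (A : 'M[F]_(m, p)) (B : 'M[F]_(m, q)) :
  mxrange A `<=` mxrange B -> exists G, A = B *m G.
Proof.
move=> sAB; have /submxP[G AG] : (A^T <= B^T)%MS; last first.
  by exists G^T; apply: trmx_inj; rewrite AG trmx_mul trmxK.
apply/row_subP => j.
have [v _ BvE] : mxrange B (A *m delta_mx j 0) by apply: sAB; exists (delta_mx j 0).
by apply/submxP; exists v^T; rewrite -trmx_mul BvE -colE tr_col.
Qed.

(** The factorization puts the column space of [A] inside that of [B]; equal ranks turn this
    inclusion into an equality. *)
Lemma mulmx_rank_eq m p q (A : 'M[F]_(m, p)) (B : 'M[F]_(m, q)) G :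
  A = B *m G -> \rank A = \rank B -> exists H, B = A *m H.
Proof.
move=> AE rAB; have sAB : (A^T <= B^T)%MS by rewrite AE trmx_mul submxMl.
have /submxP[H BH] : (B^T <= A^T)%MS.
  by rewrite -(geq_leqif (mxrank_leqif_sup sAB)) !mxrank_tr rAB.
by exists H^T; apply: trmx_inj; rewrite BH trmx_mul trmxK.
Qed.

Lemma sylvester_unitmx m n (A : 'M[F]_(m, n)) (B : 'M[F]_(n, m)) :
  1%:M + A *m B \in unitmx -> 1%:M + B *m A \in unitmx.
Proof.
move=> uAB; suff /mulmx1_unit[] :
    (1%:M + B *m A) *m (1%:M - B *m invmx (1%:M + A *m B) *m A) = 1%:M by [].
(* Moving [B] across makes [1 + A B] meet its inverse, so the product telescopes to the identity. *)
have push : (1%:M + B *m A) *m B = B *m (1%:M + A *m B).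
  by rewrite mulmxDl mulmxDr mul1mx mulmx1 mulmxA.
by rewrite mulmxBr mulmx1 !mulmxA push mulmxK // addrK.
Qed.

Lemma mulmx_invmx_swap m n (A : 'M[F]_(m, n)) (B : 'M[F]_(n, m)) :
    1%:M + A *m B \in unitmx ->
  A *m invmx (1%:M + B *m A) = invmx (1%:M + A *m B) *m A.
Proof.
move=> uAB; have uBA := sylvester_unitmx uAB.
apply: (can_inj (mulKmx uAB)); rewrite mulKVmx // mulmxA.
suff -> : (1%:M + A *m B) *m A = A *m (1%:M + B *m A) by rewrite mulmxK.
by rewrite mulmxDl mulmxDr mul1mx mulmx1 mulmxA.
Qed.

End Factorization.

(** * Weak Drazin inverses and the stable range of the powers *)

Section WeakDrazin.
Variable F : fieldType.

(** The ranges of the powers of [T] decrease and stop shrinking at the index, so the last one lies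
    in all of them. *)
Lemma mxind_stable m (T : 'M[F]_m) j :
  exists G, T ^+ mxind T = T ^+ j *m G.
Proof.
rewrite /mxind; case: ex_minnP => k /eqP rk _.
have [G TkE] : exists G, T ^+ k = T ^+ k.+1 *m G.
  by apply: (@mulmx_rank_eq _ _ _ _ _ _ T); rewrite ?rk // exprSr.
suff [H ->] : exists H, T ^+ k = T ^+ (j + k) *m H.
  by exists (T ^+ k *m H); rewrite exprD mulmxA.
elim: j => [|j [H TE]]; first by exists 1%:M; rewrite mulmx1.
exists (G *m H).
by rewrite addSnnS exprD mulmxA -[_ * _ *m G]mulmxA -TkE -[_ *m T ^+ k]exprD.
Qed.

Section Inverse.
Variables (m n : nat) (A X : 'M[F]_(m, n)) (W : 'M[F]_(n, m)).
Hypothesis hX : min_rank_weak_drazin A W X.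
Let T := A *m W.

Lemma weak_drazin_powE : T ^+ mxind T = X *m (W *m T ^+ (mxind T).+1).
Proof. by case: hX => <- _; rewrite mulmxA. Qed.

Lemma weak_drazin_range : exists G, X = T ^+ mxind T *m G.
Proof. by case: hX => _ rX; exact: mulmx_rank_eq weak_drazin_powE _. Qed.

Lemma weak_drazin_mulKmx : X *m W *m T *m X = X.
Proof.
have [G XE] := weak_drazin_range; case: hX => XT _.
by rewrite [in X in _ *m X]XE mulmxA -[_ *m T *m _]mulmxA -[T *m _]exprS XT -XE.
Qed.

(** With [k] the index and [T ^+ k = T ^+ k.+1 *m H], the defining equation gives [X W T^k = T^k H],
    hence [T X W T^k = T^k]; and [X] factors through [T^k]. *)
Lemma weak_drazin_mulVKmx : T *m (X *m W) *m X = X.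
Proof.
have [G XE] := weak_drazin_range; case: hX => XT _.
have [H TkE] := mxind_stable T (mxind T).+1.
have XWT : X *m W *m T ^+ mxind T = T ^+ mxind T *m H.
  by rewrite [in LHS]TkE mulmxA XT.
rewrite [in X in _ *m X]XE mulmxA -[_ *m T ^+ _]mulmxA XWT mulmxA.
by rewrite -[T *m _]exprS -TkE -XE.
Qed.

End Inverse.

(** A criterion with an arbitrary exponent [j], so that the index of [A W] need not be computed. The
    range of [T^k] lies in that of [T^j], hence in that of [X]; iterating [X = T X W X] gives the
    converse inclusion and thus the rank. *)
Lemma min_rank_weak_drazinP m n (A X : 'M[F]_(m, n)) (W : 'M[F]_(n, m)) j G :
    X *m W *m (A *m W) *m X = X -> A *m W *m (X *m W) *m X = X ->
    (A *m W) ^+ j = X *m G ->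
  min_rank_weak_drazin A W X.
Proof.
rewrite /min_rank_weak_drazin; move: (A *m W) => T XTX TXX TjE.
have [H TkE] := mxind_stable T j; set k := mxind T in TkE *.
have {TkE TjE} TkE : T ^+ k = X *m (G *m H) by rewrite TkE TjE mulmxA.
have [K XE] : exists K, X = T ^+ k *m K.
  elim: k {TkE} => [|k [K XE]]; first by exists X; rewrite mul1mx.
  exists (K *m W *m X).
  by rewrite exprS -[T * _]/(T *m _) -!mulmxA [T ^+ k *m _]mulmxA -XE !mulmxA
     -{1}TXX !mulmxA.
split; first by rewrite exprS -[T * _]/(T *m _) [in LHS]TkE !mulmxA XTX -mulmxA.
apply/eqP; rewrite eqn_leq {1}XE mxrankM_maxl /=.
by rewrite TkE mxrankM_maxl.
Qed.

(** The range of [X] is invariant under [T] and contains that of [X K], so the powers of [T] and of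
    [T + X K] agree modulo it. *)
Lemma expr_add_range m p (T : 'M[F]_m) (X : 'M[F]_(m, p)) (K : 'M[F]_(p, m)) j
    (L : 'M[F]_p) :
  T *m X = X *m L -> exists G, (T + X *m K) ^+ j = T ^+ j + X *m G.
Proof.
move=> TXE; elim: j => [|j [G IH]]; first by exists 0; rewrite mulmx0 addr0.
exists (L *m G + K *m (T ^+ j + X *m G)).
rewrite exprS IH [LHS]mulmxDl [T *m (_ + _)]mulmxDr [T *m (X *m G)]mulmxA TXE.
by rewrite exprS -addrA mulmxDr !mulmxA.
Qed.

(** * The weak Drazin inverse of the perturbed matrix *)

Section Perturbation.
Variables (m n : nat) (B E X : 'M[F]_(m, n)) (W : 'M[F]_(n, m)).
Hypothesis hX : min_rank_weak_drazin B W X.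
Variable H : 'M[F]_n.
Hypothesis EXH : E = X *m H.
Hypothesis uV : 1%:M + W *m E *m W *m X \in unitmx.
Let D := B + E.
Let Z := X *m invmx (1%:M + W *m E *m W *m X).

Lemma perturbation_unitmx : 1%:M + X *m W *m E *m W \in unitmx.
Proof.
have uV' : 1%:M + (W *m E *m W) *m X \in unitmx by [].
by have := sylvester_unitmx uV'; rewrite !mulmxA.
Qed.

Lemma perturbation_swap :
  X *m invmx (1%:M + W *m E *m W *m X)
  = invmx (1%:M + X *m W *m E *m W) *m X.
Proof.
have uU : 1%:M + X *m (W *m E *m W) \in unitmx.
  by rewrite !mulmxA perturbation_unitmx.
by rewrite (mulmx_invmx_swap uU) !mulmxA.
Qed.

Lemma perturbation_mulX :
  X *m W *m D *m W *m X = X *m (1%:M + W *m E *m W *m X).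
Proof.
have := weak_drazin_mulKmx hX.
by rewrite /D !(mulmxDl, mulmxDr) mulmx1 !mulmxA => ->.
Qed.

Lemma perturbation_mulKX : Z *m W *m D *m W *m X = X.
Proof.
have XWDWX := perturbation_mulX.
have UX : (1%:M + X *m W *m E *m W) *m X = X *m (1%:M + W *m E *m W *m X).
  by rewrite mulmxDl mulmxDr mulmx1 mul1mx !mulmxA.
have {UX} XWDWX : X *m (W *m D *m W *m X) = (1%:M + X *m W *m E *m W) *m X.
  by rewrite UX -XWDWX !mulmxA.
have ZE : Z *m (W *m D *m W *m X) = X.
  by rewrite /Z perturbation_swap -[LHS]mulmxA XWDWX mulKmx ?perturbation_unitmx.
by rewrite -[RHS]ZE !mulmxA.
Qed.

Lemma perturbation_drazin : min_rank_weak_drazin D W Z.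
Proof.
have TXE : forall p (K : 'M_(n, p)), B *m W *m X *m W *m X *m K = X *m K.
  by move=> p K; have := weak_drazin_mulVKmx hX; rewrite !mulmxA => ->.
have DWE : D *m W = B *m W *m (1%:M + X *m W *m E *m W).
  by rewrite /D EXH mulmxDl mulmxDr mulmx1 !mulmxA -[RHS]addrC TXE addrC.
(* Invariance of the range of [X] under [B W]: from [X = T^k G] follows [T X = T^k T G], and [T^k]
   factors through [X]. *)
have [L TXL] : exists L, B *m W *m X = X *m L.
  have [G XE] := weak_drazin_range hX.
  exists (W *m (B *m W) ^+ (mxind (B *m W)).+1 *m (B *m W *m G)).
  rewrite [in LHS]XE 2!mulmxA -(weak_drazin_powE hX).
  by rewrite -[B *m W *m _ ^+ _]exprS exprSr mulmxA.
have [G DkE] : exists G, (D *m W) ^+ mxind (B *m W) = X *m G.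
  have [G] := expr_add_range (H *m W) (mxind (B *m W)) TXL.
  rewrite mulmxA -EXH -mulmxDl => ->; rewrite (weak_drazin_powE hX) -mulmxDr.
  by eexists.
(* The exponent is the index of [B W], not of [D W]; the factor before [G] cancels the inverse in
   [Z]. *)
apply: (@min_rank_weak_drazinP _ _ _ _ _ (mxind (B *m W))
         ((1%:M + W *m E *m W *m X) *m G)).
- by rewrite {2}/Z !mulmxA perturbation_mulKX.
- by rewrite DWE {1}/Z perturbation_swap !mulmxA mulmxK ?perturbation_unitmx //.
- by rewrite DkE /Z mulmxA mulmxKV.
Qed.

End Perturbation.

End WeakDrazin.

(** * Invertibility and bounds from a submultiplicative norm *)

Section MatrixNorm.
Variables (R : realType) (n : nat) (norm : 'M[R[i]]_n -> R).
Hypothesis hnorm : matrix_norm norm.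
Implicit Types A Q : 'M[R[i]]_n.

Lemma matrix_normN A : norm (- A) = norm A.
Proof.
have := matrix_normZ hnorm (-1) A; rewrite scaleN1r normrN1 mul1r.
by case.
Qed.

(** The kernel matrix [K] is square and satisfies [K A = - K]; a nonzero [K] would force [norm A] to
    be at least 1. *)
Lemma unitmx_norm_lt1 A : norm A < 1 -> 1%:M + A \in unitmx.
Proof.
move=> A1; rewrite -row_free_unit -kermx_eq0; apply/eqP.
set K := kermx _; apply: (matrix_norm_eq0 hnorm); apply/eqP.
have KA : K *m A = - K.
  apply/eqP; rewrite -addr_eq0 addrC -{1}[K]mulmx1 -mulmxDr; apply/eqP.
  exact: mulmx_ker.
have := matrix_normM hnorm K A; have := matrix_norm_ge0 hnorm K.
rewrite KA matrix_normN le_eqVlt eq_sym => /predU1P[-> // | K0].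
by rewrite ler_pMr // leNgt A1.
Qed.

Lemma matrix_norm_inv_bounds A Q : norm A < 1 ->
  norm ((1%:M + A) *m Q) / (1 + norm A)
    <= norm Q <= norm ((1%:M + A) *m Q) / (1 - norm A).
Proof.
move=> A1; have A0 := matrix_norm_ge0 hnorm A.
have QA := matrix_normM hnorm A Q; rewrite mulmxDl mul1mx.
rewrite ler_pdivrMr ?ltr_wpDr // ler_pdivlMr ?subr_gt0 //; apply/andP; split.
  rewrite mulrDr mulr1 (le_trans (matrix_normD hnorm _ _)) //.
  by rewrite lerD2l mulrC.
rewrite mulrBr mulr1 lerBlDr -{1}[Q](addrK (A *m Q)).
rewrite (le_trans (matrix_normD hnorm _ _)) // lerD2l matrix_normN.
by rewrite mulrC.
Qed.

End MatrixNorm.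

(** * The Moore-Penrose inverse of the perturbed matrix *)

Section PseudoInverse.
Variable C : numClosedFieldType.
Variables (m n : nat) (B E : 'M[C]_(m, n)).
Hypothesis BPE : B *m (mpinv B *m E) = E.
Hypothesis EPB : E *m (mpinv B *m B) = E.
Hypothesis uV : 1%:M + mpinv B *m E \in unitmx.

Lemma mpinv_perturbation_factor : B + E = B *m (1%:M + mpinv B *m E).
Proof. by rewrite mulmxDr mulmx1 BPE. Qed.

(** The candidate has the same two projectors as [B], namely [B B^+] and [B^+ B], so it inherits the
    Hermitian conditions. *)
Lemma mpinv_perturbation :
  mpinv (B + E) = invmx (1%:M + mpinv B *m E) *m mpinv B.
Proof.
case/and4P: (mpinvP B) => /eqP BPB /eqP PBP /eqP hBP /eqP hPB.
have PBV : mpinv B *m (B + E) = (1%:M + mpinv B *m E) *m (mpinv B *m B).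
  by rewrite mulmxDl mulmxDr mul1mx -[in RHS]mulmxA EPB.
have VPB : invmx (1%:M + mpinv B *m E) *m mpinv B *m (B + E) = mpinv B *m B.
  by rewrite -mulmxA PBV mulKmx.
have BVP : (B + E) *m (invmx (1%:M + mpinv B *m E) *m mpinv B) = B *m mpinv B.
  by rewrite mpinv_perturbation_factor -mulmxA mulKVmx.
symmetry; apply: penrose_uniq; apply/and4P; split; apply/eqP.
- by rewrite BVP mulmxDr BPB -mulmxA BPE.
- by rewrite -mulmxA BVP -mulmxA [mpinv B *m (B *m _)]mulmxA PBP.
- by rewrite BVP.
- by rewrite VPB.
Qed.

Lemma mulmx_mpinv_perturbation : (B + E) *m mpinv (B + E) = B *m mpinv B.
Proof.
by rewrite mpinv_perturbation mpinv_perturbation_factor -mulmxA mulKVmx.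
Qed.

End PseudoInverse.

Theorem theorem3p19 (R : realType) (m n : nat)
  (norm : 'M[R[i]]_n -> R) (hnorm : matrix_norm norm)
  (B E X D : 'M[R[i]]_(m, n)) (W Y : 'M[R[i]]_(n, m))
  (hX : min_rank_weak_drazin B W X)
  (hY : Y = mpinv B *m B *m W *m X *m W)
  (hD : D = B + E)
  (hE1 : mxrange E `<=` mxrange (E *m W))
  (hE2 : mxrange (E *m W) `<=` mxrange ((B *m W) ^+ mxind (B *m W)))
  (* E^t* and B^t* have their ranges in C^n, the two other matrices in C^m. *)
  (hEs1 : mxrange_le (E^t*) ((E *m W)^t*))
  (hEs2 : mxrange ((E *m W)^t*) `<=` mxrange ((X *m W *m B *m W)^t*))
  (hEs3 : mxrange_le ((X *m W *m B *m W)^t*) (B^t*))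
  (hEs : mxrange (E^t*) `<=` mxrange (B^t*))
  (hlt1 : Num.max (norm (W *m E *m W *m X)) (norm (mpinv B *m E)) < 1) :
  [/\ 1%:M + W *m E *m W *m X \in unitmx,
      1%:M + X *m W *m E *m W \in unitmx,
      1%:M + Y *m E \in unitmx
    & norm (Y *m E) < 1] /\
  [/\ mpinv D *m X *m invmx (1%:M + W *m E *m W *m X) *m W *m D *m W *m X
        = mpinv D *m X *m W *m D *m W *m invmx (1%:M + X *m W *m E *m W) *m X,
      mpinv D *m X *m W *m D *m W *m invmx (1%:M + X *m W *m E *m W) *m X
        = invmx (1%:M + Y *m E) *m Y *m X
    & min_rank_weak_drazin D W (X *m invmx (1%:M + W *m E *m W *m X))] /\
  D *m mpinv D *m X *m invmx (1%:M + W *m E *m W *m X) *m W *m D *m W *m X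
    = B *m Y *m X /\
  norm (Y *m X) / (1 + norm (Y *m E))
    <= norm (mpinv D *m X *m invmx (1%:M + W *m E *m W *m X)
               *m W *m D *m W *m X)
    <= norm (Y *m X) / (1 - norm (Y *m E)).
Proof.
subst D.
have [H EH] : exists H, E = X *m H.
  have [H ->] := mxrange_subP (subset_trans hE1 hE2).
  by rewrite (weak_drazin_powE hX) -mulmxA; eexists.
have [L EL] : exists L, E = L *m B.
  have [L EsL] := mxrange_subP hEs.
  by exists (L^t*); rewrite -[E]trmxCK EsL trmxC_mul trmxCK.
have BPB : B *m mpinv B *m B = B by case/and4P: (mpinvP B) => /eqP.
(* [X = B W X W X] puts the range of [X] inside that of [B], which [B B^+] fixes. The trailing [K]
   lets the identity rewrite inside longer products. *)
have BPX p (K : 'M_(n, p)) : B *m mpinv B *m X *m K = X *m K.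
  have XB : X = B *m (W *m X *m W *m X).
    by rewrite -{1}(weak_drazin_mulVKmx hX) !mulmxA.
  by rewrite XB !mulmxA BPB.
have BPE : B *m (mpinv B *m E) = E by rewrite EH !mulmxA BPX.
have EPB : E *m (mpinv B *m B) = E.
  by rewrite EL -mulmxA [B *m _]mulmxA BPB.
have YX : Y *m X = mpinv B *m X.
  rewrite hY -!mulmxA; congr (_ *m _).
  by have := weak_drazin_mulVKmx hX; rewrite !mulmxA.
have YE : Y *m E = mpinv B *m E by rewrite EH !mulmxA YX.
move: hlt1; rewrite gt_max => /andP[normWEWX normPE].
have uV := unitmx_norm_lt1 hnorm normWEWX.
have uPE := unitmx_norm_lt1 hnorm normPE.
have uYE : 1%:M + Y *m E \in unitmx by rewrite YE.
have uU := perturbation_unitmx uV.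
have Zdrazin := perturbation_drazin hX EH uV.
have mulKX := perturbation_mulKX hX uV.
have DPX : mpinv (B + E) *m X = invmx (1%:M + Y *m E) *m Y *m X.
  by rewrite (mpinv_perturbation BPE EPB uPE) YE -[RHS]mulmxA YX mulmxA.
have lhsE : mpinv (B + E) *m X *m invmx (1%:M + W *m E *m W *m X)
    *m W *m (B + E) *m W *m X = mpinv (B + E) *m X.
  by rewrite -[in RHS]mulKX !mulmxA.
have midE : mpinv (B + E) *m X *m W *m (B + E) *m W
    *m invmx (1%:M + X *m W *m E *m W) *m X = mpinv (B + E) *m X.
  (* Once the inverse is moved to the right of [X], it cancels against
     [X W D W X = X (1 + W E W X)]. *)
  rewrite -[LHS]mulmxA -(perturbation_swap uV) -[in RHS](mulmxK uV X).
  by rewrite -(perturbation_mulX _ hX) !mulmxA.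
split; first by rewrite YE.
split.
  by split; [exact: etrans lhsE (esym midE)|exact: etrans midE DPX|].
split.
  have BYX : B *m Y *m X = X.
    by rewrite -mulmxA YX mulmxA -[LHS]mulmx1 BPX mulmx1.
  transitivity ((B + E) *m (mpinv (B + E) *m X)); last first.
    rewrite mulmxA (mulmx_mpinv_perturbation BPE EPB uPE) BYX.
    by rewrite -[LHS]mulmx1 BPX mulmx1.
  by rewrite -[in RHS]lhsE !mulmxA.
rewrite lhsE.
have -> : Y *m X = (1%:M + Y *m E) *m (mpinv (B + E) *m X).
  by rewrite DPX -mulmxA (mulKVmx uYE).
by apply: matrix_norm_inv_bounds; rewrite ?YE.
Qed.
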